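(* Let $D\subset\mathbb{R}$ be a Lebesgue measurable set of positive measure, and let $f:D\to\mathbb{R}$ be an a.e. periodic function that is Lebesgue measurable and not a.e. constant on $D$. Then every two periods of $f$ (as an a.e. periodic function) are commensurable.
   Context: A set $D\subset\mathbb{R}$ is $T$-invariant if $D+T=D$. A function $f$ with domain $D$ is called a.e. periodic with period $T$ (where $T>0$) if $D$ is $T$-invariant (exactly) and $f(x+T)=f(x)$ for almost every $x\in D$. The function $f$ is called not a.e. constant if for every $c$ the set $\{x\in D : f(x)\neq c\}$ has positive Lebesgue measure. Two nonzero real numbers are commensurable if their ratio is rational. *)

(* Defs.v *)
(* MathComp-Analysis *)
From HB Require Import structures.
From mathcomp Require Import all_boot all_order all_algebra.
From mathcomp Require Import all_classical all_reals all_analysis.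

Set Implicit Arguments.
Unset Strict Implicit.
Unset Printing Implicit Defensive.

Import Order.TTheory GRing.Theory Num.Theory.
Import numFieldNormedType.Exports.

Local Open Scope classical_set_scope.
Local Open Scope ring_scope.

(* The real line with the sigma-algebra of Lebesgue (not merely Borel)
   measurable sets: the Caratheodory sigma-algebra of the outer measure
   generated by interval length, on which [completed_lebesgue_measure] lives.
   Functions into [R] still use the Borel sigma-algebra on the codomain. *)
Notation lebesgueType R := (caratheodory_type ((@wlength R idfun)^*)%mu).

(* A function with domain D is encoded as a total function [f : R -> R]; the
   definitions below depend on its values on D only, since D + T = D. *)

Definition translation_invariant (R : realType) (D : set R) (T : R) : Prop :=
  [set x + T | x in D] = D.

Definition ae_period (R : realType) (D : set R) (f : R -> R) (T : R) : Prop :=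
  [/\ 0 < T, translation_invariant D T &
      {ae @completed_lebesgue_measure R, forall x : R, D x -> f (x + T) = f x}].

Definition ae_periodic (R : realType) (D : set R) (f : R -> R) : Prop :=
  exists T : R, ae_period D f T.

Definition not_ae_constant (R : realType) (D : set R) (f : R -> R) : Prop :=
  forall c : R, (0 < @completed_lebesgue_measure R [set x : R | D x /\ f x <> c])%E.

Definition commensurable (R : realType) (x y : R) : Prop :=
  [/\ x != 0, y != 0 & exists q : rat, x / y = ratr q].

(* Main.v *)
(* If T1 and T2 are incommensurable, the translations preserving the measure
   B |-> leb (A `&` B) on intervals, where A is D intersected with the preimage
   of a Borel set, include arbitrarily small ones.  The distribution function of
   this measure is then affine, that is, A has the same density c in every
   interval, which forces A to be null or conull.  Applied to the sublevel sets
   of f, this zero-one law makes f a.e. constant. *)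
Require Import Defs.
From HB Require Import structures.
From mathcomp Require Import all_boot all_order all_algebra.
From mathcomp Require Import all_classical all_reals all_analysis.
From mathcomp Require Import ring lra.

Set Implicit Arguments.
Unset Strict Implicit.
Unset Printing Implicit Defensive.

Import Order.TTheory GRing.Theory Num.Theory.
Import numFieldNormedType.Exports.

Local Open Scope classical_set_scope.
Local Open Scope ring_scope.

(** * Additive subgroups of the real line *)

Section subgroups.
Variables (R : realType) (H : set R).
Hypothesis subH : forall x y, H x -> H y -> H (x - y).

Lemma subgroup0 x : H x -> H 0.
Proof. by move=> Hx; rewrite -(subrr x); exact: subH. Qed.

Lemma subgroupD x y : H x -> H y -> H (x + y).
Proof.
move=> Hx Hy; rewrite -[y]opprK; apply: subH => //; rewrite -sub0r.
exact/subH/Hy/(subgroup0 Hx).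
Qed.

Lemma subgroup_natmul x n : H x -> H (n%:R * x).
Proof.
move=> Hx; elim: n => [|n IHn]; first by rewrite mul0r; exact: subgroup0 Hx.
by rewrite -natr1 mulrDl mul1r; exact: subgroupD.
Qed.

Lemma commensurable_or_small x y : H x -> H y -> 0 < x -> 0 < y ->
  commensurable x y \/ forall e, 0 < e -> exists2 g, H g & 0 < g < e.
Proof.
move=> Hx Hy x0 y0.
(* Otherwise the infimum of the positive elements of H is positive, and it
   generates H. *)
have [|nsmall] := pselect (forall e, 0 < e -> exists2 g, H g & 0 < g < e).
  by right.
left.
have {nsmall}[e e0 geH] : exists2 e, 0 < e & forall g, H g -> 0 < g -> e <= g.
  apply: contrapT => ne; apply: nsmall => e e0; apply: contrapT => ng.
  apply: ne; exists e => // g Hg g0; rewrite leNgt; apply/negP => ge.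
  by apply: ng; exists g => //; rewrite g0.
pose P := [set g | H g /\ 0 < g].
have infP : has_inf P by split; [exists x | exists e => g [Hg g0]; exact: geH].
set m := inf P.
have m0 : 0 < m.
  by apply: lt_le_trans e0 _; apply: lb_le_inf; [case: infP|move=> g []; exact: geH].
have mP g : H g -> 0 < g -> m <= g.
  by move=> Hg g0; apply: ge_inf => //; case: infP.
(* The infimum is attained: otherwise [H] has elements [m <= h < g < m + m], and [g - h] is a
   positive element of [H] below [m]. *)
have Hm : H m.
  have [g [Hg g0] gm] : exists2 g, P g & g < m + m.
    exact: inf_adherent.
  suff -> : m = g by [].
  apply/eqP; rewrite eq_le mP//= leNgt; apply/negP => mg.
  have [h [Hh h0] hg] : exists2 h, P h & h < m + (g - m).
    by apply: inf_adherent; rewrite // subr_gt0.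
  have := mP _ (subH Hg Hh); have := mP h Hh h0; lra.
(* Euclidean division by [m]: the remainder lies in [H] and in [[0, m)], so minimality of [m] forces
   it to vanish. *)
have mulP z : H z -> 0 < z -> z = (Num.truncn (z / m))%:R * m.
  move=> Hz z0; have /andP[lo hi] := truncn_itv (ltW (divr_gt0 z0 m0)).
  have Hr := subH Hz (subgroup_natmul (Num.truncn (z / m)) Hm).
  move: lo hi; rewrite ler_pdivlMr// ltr_pdivrMr// -natr1 => lo hi.
  apply: contrapT => zm; have := mP _ Hr; lra.
split; rewrite ?gt_eqF//.
exists ((Num.truncn (x / m))%:R / (Num.truncn (y / m))%:R).
rewrite {1}(mulP _ Hx x0) {1}(mulP _ Hy y0) -mulf_div divff ?gt_eqF// mulr1.
by rewrite fmorph_div !rmorph_nat.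
Qed.

End subgroups.

(** * Functions with arbitrarily small quasi-periods *)

Lemma affine_of_small_quasiperiods (R : realType) (F : R -> R) :
  (forall x y, x <= y -> 0 <= F y - F x <= y - x) ->
  (forall e, 0 < e ->
    exists2 g, 0 < g < e & forall x y, F (x + g) - F (y + g) = F x - F y) ->
  forall x y, F y - F x = (F 1 - F 0) * (y - x).
Proof.
move=> F_lip F_per.
suff wlg x y : x <= y -> F y - F x = (F 1 - F 0) * (y - x).
  move=> x y; have [/wlg//|/ltW/wlg yx] := leP x y.
  by rewrite -opprB yx; ring.
move=> xy.
(* F minus its mean slope s over a quasi-period g is g-periodic, so it
   oscillates by at most g. *)
have approx g : 0 < g -> (forall x y, F (x + g) - F (y + g) = F x - F y) ->
    exists s, forall a b, a <= b -> `|F b - F a - s * (b - a)| <= g.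
  move=> g0 gF; set c := F g - F 0; exists (c / g) => a b ab.
  have FD z n : F (z + n%:R * g) = F z + n%:R * c.
    elim: n => [|n IHn]; first by rewrite !mul0r !addr0.
    rewrite -natr1 !mulrDl !mul1r addrA.
    by have := gF (z + n%:R * g) 0; rewrite add0r IHn /c; lra.
  have ab0 : 0 <= b - a by rewrite subr_ge0.
  have /andP[lo hi] := truncn_itv (divr_ge0 ab0 (ltW g0)).
  move: lo hi; set n := Num.truncn _; rewrite ler_pdivlMr// ltr_pdivrMr//.
  rewrite -natr1 mulrDl mul1r => lo hi.
  have [c0 cg] : 0 <= c /\ c <= g.
    by have := F_lip 0 g (ltW g0); rewrite -/c subr0 => /andP[].
  (* [u] is the last point of the progression [a + k * g] not beyond [b]. Subtracting the slope
     [c / g] leaves equal values at [a] and [u], so only the stretch from [u] to [b], shorter than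
     [g], contributes. *)
  have := FD a n; set u := a + n%:R * g => Fu.
  have ub : u <= b by rewrite /u; lra.
  have -> : F b - F a - c / g * (b - a) = (F b - F u) - c / g * (b - u).
    by rewrite Fu /u; field; rewrite gt_eqF.
  have /andP[Fl Fh] := F_lip u b ub.
  have s0 : 0 <= c / g * (b - u).
    by apply: mulr_ge0; [exact: divr_ge0 c0 (ltW g0)|rewrite subr_ge0].
  have s1 : c / g * (b - u) <= b - u.
    by rewrite ler_piMl ?subr_ge0// ler_pdivrMr// mul1r.
  by rewrite ler_norml; apply/andP; split; rewrite /u in Fl Fh s0 s1 *; lra.
apply/eqP; rewrite -subr_eq0 -normr_le0; apply/ler_addgt0Pr => e e0; rewrite add0r.
(* The slope [s] errs by at most [g] on [[x, y]]. The same bound on [[0, 1]] puts [s] within [g] of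
   [F 1 - F 0], which costs a further [g * (y - x)]. The total [g * (1 + (y - x))] has to stay below
   [e]. *)
have d0 : 0 < e / (1 + (y - x)) by rewrite divr_gt0//; lra.
have [g /andP[g0]] := F_per _ d0; rewrite ltr_pdivlMr; last by lra.
move=> ge gF; have [s Fs] := approx g g0 gF.
have := Fs x y xy; have := Fs 0 1 ler01; rewrite subr0 mulr1 => F1 Fxy.
have -> : F y - F x - (F 1 - F 0) * (y - x) =
  (F y - F x - s * (y - x)) - (F 1 - F 0 - s) * (y - x) by ring.
rewrite (le_trans (ler_normB _ _))// normrM (ger0_norm (_ : 0 <= y - x)) ?subr_ge0//.
apply: le_trans (ltW ge); rewrite [leRHS]mulrDr mulr1 lerD// ler_wpM2r// subr_ge0//.
Qed.

(** * Lebesgue outer measure, translations and zero-one laws *)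

Section lebesgue_outer_measure.
Variable R : realType.
Local Notation leb := (@completed_lebesgue_measure R).
Implicit Types (A B E : set R) (a b c t : R).

(** As a function of arbitrary sets the completed measure is the outer measure itself, so the
    monotonicity and subadditivity below hold for all sets. *)
Lemma leb_outerE A : leb A = (@wlength R idfun)^*%mu A.
Proof. by []. Qed.

Lemma leb_le A B : A `<=` B -> (leb A <= leb B)%E.
Proof. exact: (@le_outer_measure _ _ (@wlength R idfun)^*%mu). Qed.

Lemma leb_setU A B : (leb (A `|` B) <= leb A + leb B)%E.
Proof. exact: (outer_measureU2 (@wlength R idfun)^*%mu). Qed.

Lemma leb_bigcup (F : (set R)^nat) :
  (leb (\bigcup_n F n) <= \sum_(n <oo) leb (F n))%E.
Proof. exact: (outer_measure_sigma_subadditive (@wlength R idfun)^*%mu). Qed.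

Lemma leb_bigcup_eq0 (F : (set R)^nat) :
  (forall n, leb (F n) = 0) -> leb (\bigcup_n F n) = 0.
Proof.
move=> F0; apply/eqP; rewrite eq_le measure_ge0 andbT.
by apply: le_trans (leb_bigcup F) _; rewrite eseries0.
Qed.

Lemma leb_itv a b : a <= b -> leb `]a, b] = (b - a)%:E.
Proof.
move=> ab; rewrite leb_outerE measurable_mu_extE; last exact: is_ocitv.
by rewrite /= wlength_itv_bnd.
Qed.

Lemma lebesgue_itv a b : measurable (`]a, b] : set (lebesgueType R)).
Proof. by apply: caratheodory_measurable_mu_ext; exact: is_ocitv. Qed.

Lemma shift_itv t a b : [set x + t | x in `]a, b]%classic] = `]a + t, b + t]%classic.
Proof.
apply/seteqP; split => [_ [x] /= + <-|x /=]; rewrite !in_itv/= => xab.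
  by rewrite ltrD2r lerD2r.
by exists (x - t); rewrite ?subrK// in_itv/= ltrBrDr lerBlDr.
Qed.

(** Translating a cover by half-open intervals keeps its total length, which gives one inequality;
    translating back by [- t] gives the other. *)
Lemma leb_shift t A : leb [set x + t | x in A] = leb A.
Proof.
have shift_le s B : (leb [set (x + s)%R | x in B] <= leb B)%E.
  rewrite !leb_outerE; apply: le_ereal_inf_tmp => _ [F [mF BF] <-].
  apply: ereal_inf_lbound; exists (fun n => [set x + s | x in F n]).
    split=> [n|_ [x /BF[n _ Fnx] <-]]; last by exists n => //; exists x.
    by have [[u v] _ <-] := mF n; rewrite shift_itv; exact: is_ocitv.
  apply: eq_eseriesr => n _; have [[u v] _ <-] := mF n.
  rewrite shift_itv !wlength_itv/= !lte_fin ltrD2r.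
  by case: ifP => // _; rewrite -!EFinB; congr (_%:E); ring.
apply/eqP; rewrite eq_le shift_le/=.
rewrite -[X in (leb X <= _)%E](_ : [set x - t | x in [set x + t | x in A]] = A).
  exact: shift_le.
apply/seteqP; split => [_ [_ [x Ax <-] <-]|x Ax]; first by rewrite addrK.
by exists (x + t); [exists x|rewrite addrK].
Qed.

Lemma leb_bounded_eq0 A :
  (forall n : nat, leb (A `&` `]- n%:R, n%:R]) = 0) -> leb A = 0.
Proof.
move=> A0; apply/eqP; rewrite eq_le measure_ge0 andbT.
rewrite -(leb_bigcup_eq0 A0); apply: leb_le => x Ax.
exists (Num.truncn `|x|).+1 => //; split => //=; rewrite in_itv/=.
have : `|x| < (Num.truncn `|x|).+1%:R by exact: truncnS_gt.
by rewrite ltr_norml => /andP[-> /ltW].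
Qed.

(* Covering a bounded subset E of the complement of A by intervals gives
   leb E <= (1 - c) leb E, hence c = 0 or leb E = 0. *)
Lemma zero_one_of_constant_density A c :
    measurable (A : set (lebesgueType R)) ->
    (forall a b, a <= b -> leb (A `&` `]a, b]) = (c * (b - a))%:E) ->
  leb A = 0 \/ leb (~` A) = 0.
Proof.
move=> mA Ac.
have c0 : 0 <= c.
  have : (0 <= leb (A `&` `]0%R, 1%R]))%E by exact: measure_ge0.
  by rewrite Ac// lee_fin subr0 mulr1.
have c1 : c <= 1.
  have : (leb (A `&` `]0%R, 1%R]) <= leb `]0%R, 1%R])%E by exact: leb_le.
  by rewrite Ac// leb_itv// lee_fin subr0 mulr1.
have [cE|cN0] := eqVneq c 0.
  left; apply: leb_bounded_eq0 => n; rewrite Ac ?cE ?mul0r//.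
  by rewrite ge0_cp.
right; apply: leb_bounded_eq0 => n; set E := _ `&` _.
have CA a b : a <= b -> leb (`]a, b] `&` ~` A) = ((1 - c) * (b - a))%:E.
  move=> ab.
  (* This is the Caratheodory criterion for [A], tested on the interval. *)
  have : (leb `]a, b] = leb (A `&` `]a, b]) + leb (`]a, b] `&` ~` A))%E.
    by rewrite [A `&` _]setIC; exact: mA.
  rewrite leb_itv// Ac// => /eqP.
  rewrite addeC -sube_eq ?fin_num_adde_defl// -EFinB => /eqP <-.
  by congr (_%:E); ring.
have Efin : leb E \is a fin_num.
  rewrite ge0_fin_numE//; apply: (@le_lt_trans _ _ (leb `](- n%:R)%R, n%:R%R])).
    by apply: leb_le => x [].
  by rewrite leb_itv ?ltry// ge0_cp.
have E_cover S : [set (\sum_(k <oo) wlength idfun (F k))%E | F in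
     @measurable_cover _ (ocitv_type R) E] S -> (leb E <= (1 - c)%:E * S)%E.
  move=> [F [mF EF] <-].
  have -> : ((1 - c)%:E * \sum_(k <oo) wlength idfun (F k) =
             \sum_(k <oo) leb (F k `&` ~` A))%E.
    rewrite -nneseriesZl; last by move=> k _; exact: wlength_ge0.
    apply: eq_eseriesr => k _; have [[u v] _ <-] /= := mF k.
    have [uv|vu] := leP u v; first by rewrite CA// wlength_itv_bnd// EFinM.
    rewrite wlength_itv/= lte_fin ltNge (ltW vu)/= mule0.
    by rewrite set_itv_ge ?set0I ?measure0// bnd_simp -leNgt ltW.
  apply: le_trans (leb_bigcup _); apply: leb_le => x Ex.
  by have [k _ Fkx] := EF _ Ex; exists k => //; split => //; case: Ex.
rewrite -(fineK Efin); set l := fine _.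
have l0 : 0 <= l by exact: fine_ge0.
have [->//|lN0] := eqVneq l 0.
have lp : 0 < l by rewrite lt_neqAle eq_sym lN0.
have cp : 0 < c by rewrite lt_neqAle eq_sym cN0.
(* With the slack [c * l] the covering bound reads [l <= (1 - c) * (l + c * l) = (1 - c ^ 2) * l],
   absurd for positive [c] and [l]. *)
have [S HS Sl] : exists2 S, [set (\sum_(k <oo) wlength idfun (F k))%E | F in
    @measurable_cover _ (ocitv_type R) E] S & (S < leb E + (c * l)%:E)%E.
  by apply: lb_ereal_inf_adherent => //; exact: mulr_gt0.
have : (leb E <= (1 - c)%:E * (leb E + (c * l)%:E))%E.
  apply: le_trans (E_cover S HS) _.
  by apply: lee_wpmul2l (ltW Sl); rewrite lee_fin subr_ge0.
rewrite -(fineK Efin) -/l -EFinD -EFinM lee_fin => L.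
by exfalso; have := mulr_gt0 cp (mulr_gt0 cp lp); nra.
Qed.

Lemma leb_ae_eq A B :
  {ae leb, forall x, A x <-> B x} -> leb A = leb B.
Proof.
suff le_ae C E : {ae leb, forall x, C x <-> E x} -> (leb C <= leb E)%E.
  move=> AB; apply/eqP; rewrite eq_le !le_ae//.
  have [N [mN N0 ABN]] := AB; exists N; split=> // x nBA.
  by apply: ABN => AB'; apply: nBA; exact: iff_sym.
move=> [N [_ N0 CEN]].
apply: (@le_trans _ _ (leb (E `|` N))).
  apply: leb_le => x Cx; have [Ex|nEx] := pselect (E x); [by left|right].
  by apply: CEN => CE; apply/nEx/CE.
by rewrite -[leRHS]adde0 -N0; exact: leb_setU.
Qed.

(** The left-hand set is an exact translate of the part in []a, b]] of [A] shifted by [- t], and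
    that shifted set agrees with [A] almost everywhere. *)
Lemma leb_itv_period A t a b : {ae leb, forall x, A (x + t) <-> A x} ->
  leb (A `&` `]a + t, b + t]) = leb (A `&` `]a, b]).
Proof.
move=> At.
have -> : A `&` `]a + t, b + t]%classic =
    [set x + t | x in [set x | A (x + t)] `&` `]a, b]%classic].
  apply/seteqP; split=> [x [Ax]|_ [x [Ax xab] <-]].
    rewrite -shift_itv => -[y yab yx]; exists y => //.
    by split=> //=; rewrite yx.
  by split=> //; rewrite -shift_itv; exists x.
rewrite leb_shift; apply: leb_ae_eq.
have [N [mN N0 AtN]] := At; exists N; split=> // x nAB.
by apply: AtN => Ax; apply: nAB; split=> -[? ?]; split=> //; exact/Ax.
Qed.

Lemma zero_one_of_small_periods A : measurable (A : set (lebesgueType R)) ->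
    (forall e, 0 < e -> exists2 g, 0 < g < e & forall a b,
      leb (A `&` `]a + g, b + g]) = leb (A `&` `]a, b])) ->
  leb A = 0 \/ leb (~` A) = 0.
Proof.
move=> mA A_per; pose nu a b := fine (leb (A `&` `]a, b])).
have nu_le a b : a <= b -> 0 <= nu a b <= b - a.
  move=> ab; have lab : (leb (A `&` `]a, b]) <= (b - a)%:E)%E.
    by rewrite -leb_itv//; apply: leb_le => x [].
  rewrite fine_ge0//= -lee_fin fineK// ge0_fin_numE//.
  by apply: le_lt_trans lab _; rewrite ltry.
have nuE a b : a <= b -> leb (A `&` `]a, b]) = (nu a b)%:E.
  move=> ab; rewrite fineK// ge0_fin_numE//.
  apply: (@le_lt_trans _ _ (b - a)%:E); last by rewrite ltry.
  by rewrite -leb_itv//; apply: leb_le => x [].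
have nu0 a b : b <= a -> nu a b = 0.
  by move=> ba; rewrite /nu set_itv_ge ?setI0 ?measure0// bnd_simp -leNgt.
have nuD a b c : a <= b -> b <= c -> nu a c = nu a b + nu b c.
  move=> ab bc; apply: EFin_inj.
  rewrite EFinD -!nuE// ?(le_trans ab)//.
  (* Additivity is the Caratheodory criterion for []a, b]], with test set the part of [A] in []a,
     c]]. *)
  have -> : (leb (A `&` `]a, c]) = leb (A `&` `]a, c] `&` `]a, b])
           + leb (A `&` `]a, c] `&` ~` `]a, b]))%E.
    exact: (lebesgue_itv a b).
  congr (leb _ + leb _)%E; apply/seteqP; split=> x /=; rewrite !in_itv/=.
  - by move=> [[Ax _]].
  - by move=> [Ax /andP[ax xb]]; rewrite ax xb (le_trans xb bc).
  - move=> [[Ax /andP[ax ->]]]; rewrite ax/= => /negP.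
    by rewrite -ltNge => ->.
  - move=> [Ax /andP[bx ->]]; rewrite (le_lt_trans ab bx); split=> //.
    by rewrite leNgt bx.
(* Since [nu] vanishes on reversed endpoints, at most one term is nonzero: this is the distribution
   function based at 0, signed on the negative axis. *)
pose F x := nu 0 x - nu x 0.
have FB x y : x <= y -> F y - F x = nu x y.
  move=> xy; rewrite /F; have [x0|x0] := leP 0 x.
    by rewrite (nuD 0 x y)// (nu0 x 0)// (nu0 y 0) ?(le_trans x0)//; ring.
  have [y0|y0] := leP 0 y.
    by rewrite (nuD x 0 y)// ?(nu0 y 0)// ?(nu0 0 x)//; [ring|exact: ltW..].
  rewrite (nuD x y 0)//; last exact: ltW.
  by rewrite (nu0 0 x) ?(nu0 0 y)//; [ring|exact: ltW..].
have F_affine : forall x y, F y - F x = (F 1 - F 0) * (y - x).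
  apply: affine_of_small_quasiperiods => [x y xy|e /A_per[g g_small gA]].
    by rewrite FB// nu_le.
  exists g => //.
  suff Fg x y : x <= y -> F (y + g) - F (x + g) = F y - F x.
    move=> x y; have [xy|/ltW yx] := leP x y; last by rewrite Fg.
    by rewrite -opprB Fg// opprB.
  by move=> xy; rewrite !FB ?lerD2r// /nu gA.
apply: (@zero_one_of_constant_density _ (F 1 - F 0)) => // a b ab.
by rewrite nuE// -FB// F_affine.
Qed.

End lebesgue_outer_measure.

(** * Incommensurable periods force a constant *)

Theorem theoremC (R : realType) (D : set R) (f : R -> R)
  (mD : measurable (D : set (lebesgueType R)))
  (D_gt0 : (0 < @completed_lebesgue_measure R D)%E)
  (f_periodic : ae_periodic D f)
  (mf : measurable_fun (D : set (lebesgueType R)) (f : lebesgueType R -> R))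
  (f_nonconst : not_ae_constant D f) :
  forall T1 T2 : R, ae_period D f T1 -> ae_period D f T2 ->
    commensurable T1 T2.
Proof.
move=> T1 T2 per1 per2; apply: contrapT => incomm.
pose leb := @completed_lebesgue_measure R.
have zero_one (B : set R) : measurable B ->
    leb (D `&` f @^-1` B) = 0 \/ leb (~` (D `&` f @^-1` B)) = 0.
  move=> mB; set A := D `&` _.
  (* Phrasing invariance through measures of intervals makes [H] a subgroup by substitution, without
     combining exceptional null sets. *)
  pose H := [set g | forall a b,
    leb (A `&` `]a + g, b + g]) = leb (A `&` `]a, b])].
  have subH x y : H x -> H y -> H (x - y).
    move=> Hx Hy a b; rewrite -(Hx a b) -(Hy (a + (x - y)) (b + (x - y))).
    by rewrite !addrA !subrK.
  have HT T : ae_period D f T -> H T.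
    move=> [_ DT [N [mN N0 fN]]] a b; apply: leb_itv_period.
    exists N; split=> // x nAx; apply: fN => fx; apply: nAx.
    (* [D] is invariant exactly, so membership in [A] can change only where [f (x + T)] differs from
       [f x]. *)
    have DTx : D (x + T) <-> D x.
      split=> [|Dx]; last by rewrite -DT; exists x.
      by rewrite -[X in X _ -> _]DT => -[y Dy /addIr <-].
    split=> -[Dx Bx].
      by have /DTx Dx' := Dx; split=> //=; rewrite -(fx Dx').
    by split; [exact/DTx|rewrite /= (fx Dx)].
  apply: zero_one_of_small_periods; first exact: mf.
  have [||//|small] := commensurable_or_small subH (HT _ per1) (HT _ per2).
  - by case: per1.
  - by case: per2.
  by move=> e /small[g Hg ge]; exists g.
have zero_le c : leb [set x | D x /\ f x <= c] = 0 \/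
    leb (~` [set x | D x /\ f x <= c]) = 0.
  have := zero_one `]-oo, c]%classic (measurable_itv _).
  suff -> : D `&` f @^-1` `]-oo, c] = [set x | D x /\ f x <= c] by [].
  by apply/seteqP; split=> x /=; rewrite in_itv.
have D_conull : leb (~` D) = 0.
  have := zero_one setT measurableT; rewrite preimage_setT setIT => -[D0|//].
  by move: D_gt0; rewrite -/leb D0 ltxx.
have not_both E : leb E = 0 -> leb (~` E) = 0 -> False.
  move=> E0 CE0; move: D_gt0; rewrite -/leb; apply/negP; rewrite -leNgt.
  apply: (@le_trans _ _ (leb (E `|` ~` E))); first by apply: leb_le; rewrite setUv.
  by apply: (le_trans (leb_setU _ _)); rewrite -/leb E0 CE0 adde0.
(* Each sublevel set of f is null or conull; the essential value of f is the
   threshold sup Z between the two cases. *)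
pose Z := [set c | leb [set x | D x /\ f x <= c] = 0].
have Z_le c d : c <= d -> Z d -> Z c.
  move=> cd; rewrite /Z /= => d0; apply/eqP; rewrite eq_le measure_ge0 andbT -d0.
  by apply: leb_le => x [Dx fx]; split=> //; exact: le_trans cd.
(* If [Z] were empty, the null complements of the sublevel sets at [- n] would cover the line; if it
   were unbounded above, the null sublevel sets at [n] would cover [D]. *)
have Z_sup : has_sup Z.
  split.
    apply: contrapT => nZ; apply: (not_both set0); first exact: measure0.
    have -> : ~` set0 = \bigcup_n ~` [set x | D x /\ f x <= - n%:R] :> set R.
      apply/esym; rewrite setC0 -subTset => x _.
      exists (Num.truncn `|f x|).+1 => //= -[_]; rewrite lerNr leNgt => /negP; apply.
      by rewrite (le_lt_trans _ (truncnS_gt _))// -normrN ler_norm.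
    apply: leb_bigcup_eq0 => n; have [Zn|//] := zero_le (- n%:R).
    by exfalso; apply: nZ; exists (- n%:R).
  apply: contrapT => nZ; apply: (not_both D) => //.
  have -> : D = \bigcup_n [set x | D x /\ f x <= n%:R].
    apply/seteqP; split=> [x Dx|x [n _ []//]].
    exists (Num.truncn `|f x|).+1 => //; split=> //.
    by rewrite ltW// (le_lt_trans (ler_norm _) (truncnS_gt _)).
  apply: leb_bigcup_eq0 => n; apply: contrapT => Zn; apply: nZ.
  by exists n%:R => c Zc; rewrite leNgt; apply/negP => /ltW/Z_le/(_ Zc).
have := f_nonconst (sup Z); apply/negP; rewrite -leNgt.
(* The lower level lies below some element of [Z], so its sublevel set is null; the upper level
   exceeds [sup Z], so its sublevel set is conull. The sets [N n] together contain every point of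
   [D] where [f] differs from [sup Z]. *)
pose N n := [set x | D x /\ f x <= sup Z - n.+1%:R^-1] `|`
  ~` [set x | D x /\ f x <= sup Z + n.+1%:R^-1].
have N0 n : leb (N n) = 0.
  have n0 : 0 < n.+1%:R^-1 :> R by rewrite invr_gt0.
  apply/eqP; rewrite eq_le measure_ge0 andbT.
  apply: (le_trans (leb_setU _ _)); rewrite -/leb.
  have [c Zc /ltW/Z_le/(_ Zc) ->] := sup_adherent n0 Z_sup.
  have [Zs|->] := zero_le (sup Z + n.+1%:R^-1); last by rewrite adde0.
  by have := ub_le_sup (proj2 Z_sup) Zs; rewrite gerDl leNgt n0.
rewrite -(leb_bigcup_eq0 N0); apply: leb_le => x [Dx /eqP fx].
have [n nfx] : exists n, n.+1%:R^-1 < `|f x - sup Z|.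
  exists (Num.truncn `|f x - sup Z|^-1).
  rewrite invf_plt ?posrE ?normr_gt0 ?subr_eq0//; exact: truncnS_gt.
exists n => //; move: nfx.
have [fZ|Zf] := leP (f x) (sup Z).
  rewrite ler0_norm ?subr_le0// opprB ltrBrDr addrC => nfx.
  by left; split=> //=; rewrite lerBrDr ltW.
rewrite gtr0_norm ?subr_gt0// => nfx; right=> -[_] /=.
by rewrite leNgt -ltrBrDl nfx.
Qed.
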